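(* Let $L,M,N$ be positive integers and let $g:=\{g_l\}_{l\in\mathbb{N}_L}\subset\ell^2(\mathbb{Z}\times\mathbb{Z},\mathbb{H})$ be such that $\mathcal{G}(g,L,M,N)$ is an orthonormal basis for $\ell^2(\mathbb{Z}\times\mathbb{Z},\mathbb{H})$. Then $L$ is a perfect square.
   Context: $\mathbb{H}$ is the algebra of real quaternions with imaginary units $i,j,ij$. For a positive integer $K$, $\mathbb{N}_K:=\{0,1,\dots,K-1\}$. $\ell^2(\mathbb{Z}\times\mathbb{Z},\mathbb{H})$ is the right quaternionic Hilbert space of functions $f:\mathbb{Z}^2\to\mathbb{H}$ with $\sum_{k\in\mathbb{Z}^2}|f(k)|^2<\infty$, with inner product $\langle f,g\rangle=\sum_{k\in\mathbb{Z}^2}\overline{f(k)}\,g(k)$ and scalars acting on the right. For $n\in\mathbb{Z}^2$, $(T_{nN}f)(k)=f(k-nN)$ where $nN=(n_1N,n_2N)$. For $m=(m_1,m_2)\in\mathbb{N}_M^2$, $(E_{\frac mM}f)(k)=e^{2\pi i\frac{m_1}{M}k_1}f(k)e^{2\pi j\frac{m_2}{M}k_2}$, $k=(k_1,k_2)\in\mathbb{Z}^2$. The Gabor system is the indexed family $\mathcal{G}(g,L,M,N):=\{E_{\frac mM}T_{nN}g_l\}_{l\in\mathbb{N}_L,\,m\in\mathbb{N}_M^2,\,n\in\mathbb{Z}^2}$. *)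

(* Defs.v *)
(* MathComp / MathComp-Analysis *)
From HB Require Import structures.
From mathcomp Require Import all_boot all_order all_algebra.
From mathcomp Require Import ring.
From mathcomp Require Import all_classical all_reals all_analysis.

Set Implicit Arguments.
Unset Strict Implicit.
Unset Printing Implicit Defensive.

Import Order.TTheory GRing.Theory Num.Theory.
Local Open Scope classical_set_scope.
Local Open Scope ring_scope.

(* [Quaternion a b c d] is a + b i + c j + d ij. *)
Record quaternion (R : Type) :=
  Quaternion { qre : R; qimi : R; qimj : R; qimk : R }.

Definition quaternion_enc (R : Type) (q : quaternion R) :=
  (qre q, qimi q, qimj q, qimk q).
Definition quaternion_dec (R : Type) (t : R * R * R * R) :=
  let: (a, b, c, d) := t in Quaternion a b c d.
Lemma quaternion_encK (R : Type) :
  cancel (@quaternion_enc R) (@quaternion_dec R).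
Proof. by case. Qed.

HB.instance Definition _ (R : eqType) :=
  Equality.copy (quaternion R) (can_type (@quaternion_encK R)).
HB.instance Definition _ (R : choiceType) :=
  Choice.copy (quaternion R) (can_type (@quaternion_encK R)).

Section QuaternionZmodule.
Variable R : zmodType.
Implicit Types p q r : quaternion R.

Definition qzero : quaternion R := Quaternion 0 0 0 0.
Definition qopp p := Quaternion (- qre p) (- qimi p) (- qimj p) (- qimk p).
Definition qadd p q :=
  Quaternion (qre p + qre q) (qimi p + qimi q) (qimj p + qimj q) (qimk p + qimk q).

Lemma qaddA : associative qadd.
Proof. by move=> p q r; rewrite /qadd /= !addrA. Qed.
Lemma qaddC : commutative qadd.
Proof.
move=> p q; rewrite /qadd (addrC (qre p)) (addrC (qimi p)).
by rewrite (addrC (qimj p)) (addrC (qimk p)).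
Qed.
Lemma qadd0 : left_id qzero qadd.
Proof. by case=> a b c d; rewrite /qadd /= !add0r. Qed.
Lemma qaddN : left_inverse qzero qopp qadd.
Proof. by move=> p; rewrite /qadd /= !addNr. Qed.

HB.instance Definition _ :=
  GRing.isZmodule.Build (quaternion R) qaddA qaddC qadd0 qaddN.
End QuaternionZmodule.

Section QuaternionRing.
Variable R : comNzRingType.
Implicit Types p q r : quaternion R.

Definition qone : quaternion R := Quaternion 1 0 0 0.

Definition qmul p q :=
  let: Quaternion a b c d := p in
  let: Quaternion a' b' c' d' := q in
  Quaternion (a * a' - b * b' - c * c' - d * d')
             (a * b' + b * a' + c * d' - d * c')
             (a * c' - b * d' + c * a' + d * b')
             (a * d' + b * c' - c * b' + d * a').

Lemma qmulA : associative qmul.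
Proof.
by move=> [a b c d] [a' b' c' d'] [x y z t]; rewrite /qmul; congr Quaternion; ring.
Qed.
Lemma qmul1l : left_id qone qmul.
Proof. by move=> [a b c d]; rewrite /qmul /=; congr Quaternion; ring. Qed.
Lemma qmul1r : right_id qone qmul.
Proof. by move=> [a b c d]; rewrite /qmul /=; congr Quaternion; ring. Qed.
Lemma qmulDl : left_distributive qmul +%R.
Proof.
by move=> [a b c d] [a' b' c' d'] [x y z t]; rewrite /qmul; congr Quaternion => /=; ring.
Qed.
Lemma qmulDr : right_distributive qmul +%R.
Proof.
by move=> [a b c d] [a' b' c' d'] [x y z t]; rewrite /qmul; congr Quaternion => /=; ring.
Qed.
Lemma qone_neq0 : qone != 0.
Proof. by apply/eqP => -[/eqP]; rewrite oner_eq0. Qed.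

HB.instance Definition _ := GRing.Zmodule_isNzRing.Build (quaternion R)
  qmulA qmul1l qmul1r qmulDl qmulDr qone_neq0.

Definition qreal (a : R) : quaternion R := Quaternion a 0 0 0.
Definition qi : quaternion R := Quaternion 0 1 0 0.
Definition qj : quaternion R := Quaternion 0 0 1 0.

Definition qconj p := Quaternion (qre p) (- qimi p) (- qimj p) (- qimk p).

Lemma qi_sqr : qi * qi = -1.
Proof. by congr Quaternion => /=; ring. Qed.
Lemma qj_sqr : qj * qj = -1.
Proof. by congr Quaternion => /=; ring. Qed.
Lemma qjqi : qj * qi = - (qi * qj).
Proof. by congr Quaternion => /=; ring. Qed.
Lemma qijE : qi * qj = Quaternion 0 0 0 1.
Proof. by congr Quaternion => /=; ring. Qed.

End QuaternionRing.

Arguments qi {R}.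
Arguments qj {R}.

Section Ell2.
Variable R : realType.
Local Notation H := (quaternion R).

Definition qnorm (q : H) : R :=
  Num.sqrt (qre q ^+ 2 + qimi q ^+ 2 + qimj q ^+ 2 + qimk q ^+ 2).

(* e^(u t) for an imaginary unit u (u * u = -1), by Euler's formula. *)
Definition qexp (u : H) (t : R) : H := qreal (cos t) + u * qreal (sin t).

Variable K : choiceType.
Implicit Types f g : K -> H.

Definition ell2_sqnorm f : \bar R := (\esum_(k in [set: K]) (qnorm (f k) ^+ 2)%:E)%E.

Definition ell2 f : Prop := (ell2_sqnorm f < +oo)%E.

Definition ell2_norm f : R := Num.sqrt (fine (ell2_sqnorm f)).

(* [esum] only adds nonnegative terms, hence the splitting into positive and
   negative parts; the result is meaningful when F is absolutely summable. *)
Definition rsum (F : K -> R) : R :=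
  fine (\esum_(k in [set: K]) (EFin \o F)^\+ k)%E
  - fine (\esum_(k in [set: K]) (EFin \o F)^\- k)%E.

Definition qsum (F : K -> H) : H :=
  Quaternion (rsum (fun k => qre (F k))) (rsum (fun k => qimi (F k)))
             (rsum (fun k => qimj (F k))) (rsum (fun k => qimk (F k))).

Definition ell2_inner f g : H := qsum (fun k => qconj (f k) * g k).

Definition right_span (I : Type) (e : I -> K -> H) : set (K -> H) :=
  [set h | exists (s : seq I) (c : I -> H),
             h = fun k => \sum_(i <- s) e i k * c i].

(* An orthonormal family of ell2 whose closed right linear span is all of ell2.
   As e is an indexed family, members with distinct indices are orthogonal. *)
Definition orthonormal_basis (I : eqType) (e : I -> K -> H) : Prop :=
  [/\ forall i, ell2 (e i),
      forall i j, ell2_inner (e i) (e j) = (i == j)%:R &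
      forall f, ell2 f -> forall eps : R, 0 < eps ->
        exists2 h, right_span e h & ell2_norm (f \- h) < eps].

End Ell2.

Section Gabor.
Variable R : realType.
Local Notation H := (quaternion R).
Implicit Type f : int * int -> H.

Definition translate (a : int * int) f : int * int -> H := fun k => f (k - a).

Definition modulate (M : nat) (m : 'I_M * 'I_M) f : int * int -> H := fun k =>
  qexp qi (2 * pi * (m.1%:R / M%:R) * k.1%:~R) * f k *
  qexp qj (2 * pi * (m.2%:R / M%:R) * k.2%:~R).

Definition gabor (L M N : nat) (g : 'I_L -> int * int -> H)
    (i : 'I_L * ('I_M * 'I_M) * (int * int)) : int * int -> H :=
  let: (l, m, n) := i in modulate m (translate (n *+ N) (g l)).

End Gabor.

Arguments gabor {R L} M N g i.

(* Main.v *)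
(* For a point mass at [k], Parseval's identity says that the values at [k] of the
   members of an orthonormal basis have squared moduli summing to 1.  Modulations
   do not change moduli, so summing this over the [N ^ 2] residues [k] modulo [N]
   rearranges to [M ^ 2] times the sum of the squared norms of the [g l], each of
   which is 1.  Hence [N ^ 2 = L * M ^ 2]. *)
Require Import Defs.
From mathcomp Require Import all_boot all_order all_algebra.
From mathcomp Require Import finmap ring lra.
From mathcomp Require Import all_classical all_reals all_analysis.

Set Implicit Arguments.
Unset Strict Implicit.
Unset Printing Implicit Defensive.

Import Order.TTheory GRing.Theory Num.Theory.
Local Open Scope classical_set_scope.
Local Open Scope ring_scope.

(** * Squared modulus of quaternions *)

Section QuaternionNorm.
Variable R : realType.
Implicit Types p q x w : quaternion R.

Definition qsqn q : R := qre q ^+ 2 + qimi q ^+ 2 + qimj q ^+ 2 + qimk q ^+ 2.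

Lemma qsqn_ge0 q : 0 <= qsqn q.
Proof. by rewrite !addr_ge0 ?sqr_ge0. Qed.

Lemma sqr_qnorm q : qnorm q ^+ 2 = qsqn q.
Proof. by rewrite sqr_sqrtr// qsqn_ge0. Qed.

Lemma qsqnM p q : qsqn (p * q) = qsqn p * qsqn q.
Proof. by case: p q => [a b c d] [a' b' c' d']; rewrite /qsqn/=; ring. Qed.

(** The last term is left as [qre (qconj q * q)] so that putting a finite sum for [q] expands it
    into pairwise products. *)
Lemma qsqnB p q :
  qsqn (p - q) = qsqn p - 2 * qre (qconj p * q) + qre (qconj q * q).
Proof. by case: p q => [a b c d] [a' b' c' d']; rewrite /qsqn/=; ring. Qed.

Lemma qsqn_qexpi (t : R) : qsqn (qexp qi t) = 1.
Proof. by rewrite -(cos2Dsin2 t) /qsqn/=; ring. Qed.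

Lemma qsqn_qexpj (t : R) : qsqn (qexp qj t) = 1.
Proof. by rewrite -(cos2Dsin2 t) /qsqn/=; ring. Qed.

Lemma qre_sum (I : Type) (s : seq I) (F : I -> quaternion R) :
  qre (\sum_(i <- s) F i) = \sum_(i <- s) qre (F i).
Proof. exact: (big_morph (@qre R)). Qed.

Lemma qconj_sum (I : Type) (s : seq I) (F : I -> quaternion R) :
  qconj (\sum_(i <- s) F i) = \sum_(i <- s) qconj (F i).
Proof.
apply: (big_morph (@qconj R)) => [[a b c d] [a' b' c' d']|].
  by congr Quaternion => /=; ring.
by congr Quaternion => /=; rewrite oppr0.
Qed.

Lemma qconj_bool (b : bool) : qconj b%:R = b%:R :> quaternion R.
Proof. by case: b; congr Quaternion; rewrite /= oppr0. Qed.

(** Real parts are invariant under cyclic permutation, so both coefficients gather in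
    [z = w * qconj x]. When [p] and [q] vary with the summation point, [z] stays constant and only
    the components of [qconj p * q] are summed. *)
Lemma qre_conjM p q x w :
  qre (qconj (p * x) * (q * w)) =
  let z := w * qconj x in
  qre z * qre (qconj p * q) - qimi z * qimi (qconj p * q)
  - qimj z * qimj (qconj p * q) - qimk z * qimk (qconj p * q).
Proof.
by case: p q x w => [a b c d] [a' b' c' d'] [x y z t] [x' y' z' t'] /=; ring.
Qed.

(** A component is at most the modulus [|p||q|], which is below the sum of squares. This makes inner
    products in [ell2] absolutely summable. *)
Lemma qconjM_bound p q (X := qconj p * q) (B := qsqn p + qsqn q) :
  [/\ `|qre X| <= B, `|qimi X| <= B, `|qimj X| <= B & `|qimk X| <= B].
Proof.
have comp_le z : [/\ qre z ^+ 2 <= qsqn z, qimi z ^+ 2 <= qsqn z,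
    qimj z ^+ 2 <= qsqn z & qimk z ^+ 2 <= qsqn z].
  have := (sqr_ge0 (qre z), sqr_ge0 (qimi z), sqr_ge0 (qimj z), sqr_ge0 (qimk z)).
  by case=> -[[]] *; rewrite /qsqn; split; lra.
have XB : qsqn X <= B ^+ 2.
  have -> : qsqn X = qsqn p * qsqn q.
    rewrite /X qsqnM; congr (_ * _).
    by rewrite /qsqn/=; ring.
  by rewrite /B; have := (qsqn_ge0 p, qsqn_ge0 q); case; nra.
have B0 : 0 <= B by rewrite addr_ge0// qsqn_ge0.
have [h1 h2 h3 h4] := comp_le X.
by split; rewrite -ler_sqr ?nnegrE// real_normK ?num_real//;
  apply: le_trans XB.
Qed.

End QuaternionNorm.

(** * Calculus of absolutely summable real families *)

Section AbsolutelySummable.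
Variables (R : realType) (K : choiceType).
Implicit Types F G B : K -> R.

(* Presenting [F] as a difference of nonnegative summable families, rather than
   through [rsum], makes linearity immediate. *)
Definition has_rsum F (s : R) : Prop := exists f g : K -> R, exists a b : R,
  [/\ forall k, 0 <= f k /\ 0 <= g k,
      \esum_(k in [set: K]) (f k)%:E = a%:E,
      \esum_(k in [set: K]) (g k)%:E = b%:E,
      forall k, F k = f k - g k & s = a - b].

(** From [f = F + g] the nonnegative sums add up, and the finite sum of [g] cancels. *)
Lemma has_rsum_esum F s : (forall k, 0 <= F k) -> has_rsum F s ->
  \esum_(k in [set: K]) (F k)%:E = s%:E.
Proof.
move=> F0 [f [g [a [b [fg0 fa gb FE ->]]]]].
rewrite EFinB -fa -gb; under [in RHS]eq_esum => k _.
  by rewrite (_ : f k = F k + g k) ?EFinD; [over|rewrite FE subrK].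
rewrite esumD => [|k _|k _]; rewrite ?lee_fin ?F0//; last by case: (fg0 k).
by rewrite gb addeK.
Qed.

Lemma ge0_has_rsum F s : (forall k, 0 <= F k) ->
  \esum_(k in [set: K]) (F k)%:E = s%:E -> has_rsum F s.
Proof.
move=> F0 Fs; exists F, (fun=> 0), s, 0; split=> //.
- by rewrite esum1.
- by move=> k; rewrite subr0.
- by rewrite subr0.
Qed.

(** The positive and negative parts are dominated by [B], so both sums are finite and [fine] in
    [rsum] loses nothing. *)
Lemma le_has_rsum F B : (forall k, `|F k| <= B k) ->
  (\esum_(k in [set: K]) (B k)%:E < +oo)%E -> has_rsum F (rsum F).
Proof.
move=> FB Boo.
have part (h : K -> R) : (forall k, 0 <= h k) -> (forall k, h k <= `|F k|) ->
    \esum_(k in [set: K]) (h k)%:E =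
    (fine (\esum_(k in [set: K]) (h k)%:E))%:E.
  move=> h0 hF; rewrite fineK// ge0_fin_numE; last first.
    by apply: esum_ge0 => k _; rewrite lee_fin.
  apply: le_lt_trans Boo; apply: le_esum => k _.
  by rewrite lee_fin (le_trans (hF k)).
have posE k : (EFin \o F)^\+%E k = (Num.max (F k) 0)%:E.
  by rewrite funeposE /= EFin_max.
have negE k : (EFin \o F)^\-%E k = (Num.max (- F k) 0)%:E.
  by rewrite funenegE /= EFin_max.
exists (fun k => Num.max (F k) 0), (fun k => Num.max (- F k) 0).
eexists; eexists; split.
- by move=> k; rewrite !le_max lexx !orbT.
- apply: part => k; first by rewrite le_max lexx orbT.
  by rewrite ge_max ler_norm normr_ge0.
- apply: part => k; first by rewrite le_max lexx orbT.
  by rewrite ge_max -normrN ler_norm normr_ge0.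
- by move=> k; case: (lerP (F k) 0) => h; case: (lerP (- F k) 0) => h'; lra.
- rewrite /rsum; congr (fine _ - fine _).
    by apply: eq_esum => k _; exact: posE.
  by apply: eq_esum => k _; exact: negE.
Qed.

Lemma has_rsumD F G s t :
  has_rsum F s -> has_rsum G t -> has_rsum (fun k => F k + G k) (s + t).
Proof.
move=> [f [g [a [b [fg0 fa gb FE ->]]]]] [f' [g' [a' [b' [fg0' fa' gb' GE ->]]]]].
exists (f \+ f'), (g \+ g'), (a + a'), (b + b'); split.
- move=> k; have [[? ?] [? ?]] := (fg0 k, fg0' k).
  by split; rewrite addr_ge0.
- rewrite EFinD -fa -fa' -esumD// => k _; rewrite lee_fin; first by case: (fg0 k).
  by case: (fg0' k).
- rewrite EFinD -gb -gb' -esumD// => k _; rewrite lee_fin; first by case: (fg0 k).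
  by case: (fg0' k).
- by move=> k; rewrite FE GE /=; ring.
- by ring.
Qed.

Lemma has_rsumN F s : has_rsum F s -> has_rsum (fun k => - F k) (- s).
Proof.
move=> [f [g [a [b [fg0 fa gb FE ->]]]]]; exists g, f, b, a; split=> //.
- by move=> k; have [] := fg0 k.
- by move=> k; rewrite FE opprB.
- by rewrite opprB.
Qed.

Lemma has_rsumB F G s t :
  has_rsum F s -> has_rsum G t -> has_rsum (fun k => F k - G k) (s - t).
Proof. by move=> hF /has_rsumN; exact: has_rsumD. Qed.

Lemma has_rsumZ (c : R) F s : has_rsum F s -> has_rsum (fun k => c * F k) (c * s).
Proof.
have esumZ (d : R) (h : K -> R) : 0 <= d -> (forall k, 0 <= h k) ->
    (\esum_(k in [set: K]) (d * h k)%:E = d%:E * \esum_(k in [set: K]) (h k)%:E)%E.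
  have leZ (d' : R) (h' : K -> R) : 0 <= d' -> (forall k, 0 <= h' k) ->
      (\esum_(k in [set: K]) (d' * h' k)%:E
         <= d'%:E * \esum_(k in [set: K]) (h' k)%:E)%E.
    move=> d0 h0; apply: ge_ereal_sup => _ [X [finX _] <-].
    rewrite (_ : (\sum_(k \in X) _)%E = (d'%:E * \sum_(k \in X) (h' k)%:E)%E).
      apply: lee_wpmul2l; first by rewrite lee_fin.
      by apply: esum_ge; exists X.
    by rewrite ge0_mule_fsumr// => k; rewrite lee_fin.
  rewrite le_eqVlt => /predU1P[<-|d0] h0.
    by rewrite mul0e esum1// => k _; rewrite mul0r.
  apply/eqP; rewrite eq_le; apply/andP; split; first by apply: leZ; rewrite ?ltW.
  (* The reverse inequality is [leZ] for the factor [d^-1] and the family [d * h]. *)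
  rewrite -lee_pdivlMl//.
  apply: le_trans (leZ d^-1 (fun k => d * h k) _ _).
  - by apply: le_esum => k _; rewrite mulKf// gt_eqF.
  - by rewrite invr_ge0 ltW.
  - by move=> k; rewrite mulr_ge0// ltW.
have ge0Z d : 0 <= d -> has_rsum F s -> has_rsum (fun k => d * F k) (d * s).
  move=> d0 [f [g [a [b [fg0 fa gb FE ->]]]]].
  exists (fun k => d * f k), (fun k => d * g k), (d * a), (d * b); split.
  - by move=> k; have [? ?] := fg0 k; rewrite !mulr_ge0.
  - by rewrite esumZ// => [|k]; [rewrite fa|case: (fg0 k)].
  - by rewrite esumZ// => [|k]; [rewrite gb|case: (fg0 k)].
  - by move=> k; rewrite FE mulrBr.
  - by rewrite mulrBr.
have [/ge0Z//|c0 hF] := leP 0 c.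
have := has_rsumN (ge0Z (- c) _ hF); rewrite mulNr opprK; under eq_fun do rewrite mulNr opprK.
by apply; rewrite oppr_ge0 ltW.
Qed.

Lemma has_rsum_sum (J : Type) (r : seq J) (F : J -> K -> R) (s : J -> R) :
  (forall j, has_rsum (F j) (s j)) ->
  has_rsum (fun k => \sum_(j <- r) F j k) (\sum_(j <- r) s j).
Proof.
move=> Fs; elim: r => [|j r ih].
  under eq_fun do rewrite big_nil.
  by rewrite big_nil; apply: ge0_has_rsum => //; rewrite esum1.
by under eq_fun do rewrite big_cons; rewrite big_cons; exact: has_rsumD.
Qed.

Lemma has_rsum_point k0 (F : K -> R) :
  has_rsum (fun k => if k == k0 then F k else 0) (F k0).
Proof.
have pt (h : K -> R) : (forall k, 0 <= h k) ->
    has_rsum (fun k => if k == k0 then h k else 0) (h k0).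
  move=> h0; apply: ge0_has_rsum => [k|]; first by case: ifP.
  have <- : \esum_(k in [set k0]) (h k)%:E = (h k0)%:E by rewrite esum_set1// lee_fin.
  rewrite [RHS]esum_mkcond.
  by apply: eq_esum => k _; rewrite in_set1; case: ifP.
(* The nonnegative case applies to the positive and negative parts separately. *)
have := has_rsumB (pt (fun k => Num.max (F k) 0) _) (pt (fun k => Num.max (- F k) 0) _).
have maxB x : Num.max x 0 - Num.max (- x) 0 = x :> R.
  by case: (lerP x 0) => h; case: (lerP (- x) 0) => h'; lra.
rewrite maxB (_ : (fun k => _ - _) = (fun k => if k == k0 then F k else 0)).
  by apply=> k; rewrite le_max lexx orbT.
by apply/funext => k; case: ifP => _; rewrite ?maxB ?subr0.
Qed.

End AbsolutelySummable.

(** * Parseval's identity for a point mass *)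

Section Parseval.
Variables (R : realType) (K I : choiceType) (e : I -> K -> quaternion R).
Hypothesis e_ell2 : forall i, ell2 (e i).
Hypothesis e_orth : forall i j, ell2_inner (e i) (e j) = (i == j)%:R.

Lemma has_rsum_qconjM i j (x w : quaternion R) :
  has_rsum (fun k => qre (qconj (e i k * x) * (e j k * w)))
    (if i == j then qre (w * qconj x) else 0).
Proof.
have Boo : (\esum_(k in [set: K]) (qsqn (e i k) + qsqn (e j k))%:E < +oo)%E.
  have := lte_add_pinfty (e_ell2 i) (e_ell2 j).
  rewrite /ell2_sqnorm -esumD => [|k _|k _]; rewrite ?lee_fin ?sqr_ge0//.
  by under eq_esum do rewrite !sqr_qnorm -EFinD.
have B k := qconjM_bound (e i k) (e j k).
have sum1 (c : quaternion R -> R) :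
    (forall k, `|c (qconj (e i k) * e j k)| <= qsqn (e i k) + qsqn (e j k)) ->
    forall a, has_rsum (fun k => a * c (qconj (e i k) * e j k))
                 (a * rsum (fun k => c (qconj (e i k) * e j k))).
  by move=> cB a; apply: has_rsumZ; exact: le_has_rsum Boo.
have h1 := sum1 (@qre R) (fun k => let: And4 h _ _ _ := B k in h).
have h2 := sum1 (@qimi R) (fun k => let: And4 _ h _ _ := B k in h).
have h3 := sum1 (@qimj R) (fun k => let: And4 _ _ h _ := B k in h).
have h4 := sum1 (@qimk R) (fun k => let: And4 _ _ _ h := B k in h).
under eq_fun do rewrite qre_conjM /=.
set z := w * qconj x.
have := has_rsumB (has_rsumB (has_rsumB (h1 (qre z)) (h2 (qimi z))) (h3 (qimj z)))
  (h4 (qimk z)).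
(* Orthonormality fixes all four components of the inner product: the last three vanish, and the
   real one is 1 or 0. *)
have := e_orth i j; rewrite /ell2_inner /qsum.
case: eqP => _ [-> -> -> ->]; congr has_rsum; rewrite /=; ring.
Qed.

(* [qconj (e i k0)] is the [i]-th coordinate of the point mass at [k0].  The choice
   [c i = qconj (e i k0)] gives Bessel's inequality, and density of the span makes
   the left-hand side arbitrarily small, which gives the converse. *)
Lemma sqdist_point k0 (s : seq I) (c : I -> quaternion R) : uniq s ->
  \esum_(k in [set: K]) (qsqn ((k == k0)%:R - \sum_(i <- s) e i k * c i))%:E =
  (1 - \sum_(i <- s) qsqn (e i k0)
     + \sum_(i <- s) qsqn (c i - qconj (e i k0)))%:E.
Proof.
move=> s_uniq; apply: has_rsum_esum => [k|]; first exact: qsqn_ge0.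
have hdiag := has_rsum_sum s (fun i =>
  has_rsum_sum s (fun j => has_rsum_qconjM i j (c i) (c j))).
have hlin := has_rsum_point k0 (fun k => qre (\sum_(i <- s) e i k * c i)).
have hpt := has_rsum_point k0 (fun=> 1 : R).
have := has_rsumD (has_rsumB hpt (has_rsumZ 2 hlin)) hdiag.
congr has_rsum.
  apply/funext => k; rewrite qsqnB; congr (_ - _ * _ + _).
  - by case: eqP => _; rewrite /qsqn/=; ring.
  - by rewrite qconj_bool; case: eqP => _; rewrite ?mul1r ?mul0r.
  - rewrite qconj_sum mulr_suml qre_sum; apply: eq_bigr => i _.
    by rewrite mulr_sumr qre_sum.
(* Since [s] has no repetitions, each row of the double sum retains exactly one diagonal term. *)
have -> : \sum_(i <- s) \sum_(j <- s) (if i == j then qre (c j * qconj (c i)) else 0)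
    = \sum_(i <- s) qsqn (c i).
  rewrite big_seq [RHS]big_seq; apply: eq_bigr => i si.
  rewrite (bigD1_seq i)//= eqxx big1 ?addr0 => [|j /negPf]; last by rewrite eq_sym => ->.
  by rewrite /qsqn; case: (c i) => ? ? ? ? /=; ring.
(* What remains is completing the square in each [c i] around [qconj (e i k0)]. *)
rewrite qre_sum mulr_sumr -addrA -[in RHS]addrA; congr (1 + _).
rewrite -!sumrN -!big_split/=; apply: eq_bigr => i _.
by rewrite /qsqn; case: (c i) (e i k0) => ? ? ? ? [? ? ? ?] /=; ring.
Qed.

Lemma ell2_sqnorm_orthonormal i : ell2_sqnorm (e i) = 1%E.
Proof.
rewrite /ell2_sqnorm; under eq_esum do rewrite sqr_qnorm.
apply: has_rsum_esum => [k|]; first exact: qsqn_ge0.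
have := has_rsum_qconjM i i 1 1; rewrite eqxx; congr has_rsum.
  by apply/funext => k; rewrite !mulr1; case: (e i k) => ? ? ? ?; rewrite /qsqn/=; ring.
by rewrite /=; ring.
Qed.

Hypothesis e_dense : forall f, ell2 f -> forall eps : R, 0 < eps ->
  exists2 h, right_span e h & ell2_norm (f \- h) < eps.

Lemma parseval_point k0 :
  \esum_(i in [set: I]) (qnorm (e i k0) ^+ 2)%:E = 1%E.
Proof.
under eq_esum do rewrite sqr_qnorm.
apply/eqP; rewrite eq_le; apply/andP; split.
  apply: ge_ereal_sup => _ [X [finX _] <-].
  rewrite fsbig_finite// sumEFin lee_fin.
  have := sqdist_point k0 (fun i => qconj (e i k0)) (fset_uniq (fset_set X)).
  rewrite [X in _ + X]big1 ?addr0 => [|i _]; last first.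
    by rewrite subrr /qsqn/= expr0n/= !addr0.
  move=> h; rewrite -subr_ge0 -lee_fin -h; apply: esum_ge0 => k _.
  by rewrite lee_fin qsqn_ge0.
apply/lee_addgt0Pr => eps eps0.
pose d k : quaternion R := (k == k0)%:R.
have d_ell2 : ell2 d.
  rewrite /ell2 /ell2_sqnorm.
  under eq_esum do rewrite sqr_qnorm.
  have := has_rsum_esum _ (has_rsum_point k0 (fun=> 1 : R)).
  rewrite (_ : esum _ _ = esum [set: K] (fun k => (qsqn (d k))%:E)).
    by move=> ->; [exact: ltry|move=> k; case: ifP].
  by apply: eq_esum => k _; rewrite /d; case: eqP => _; congr EFin; rewrite /qsqn/=; ring.
(* Density bounds a distance while [sqdist_point] computes its square, hence the root. *)
have sq0 : 0 < Num.sqrt eps by rewrite sqrtr_gt0.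
have [_ [s [c ->]]] := e_dense d_ell2 sq0.
(* A member of [right_span] may list an index several times; repetitions are merged into
   multiplicities so that [sqdist_point] applies. *)
pose c' i := c i *+ count_mem i s.
have -> : (fun k => \sum_(i <- s) e i k * c i) =
    fun k => \sum_(i <- undup s) e i k * c' i.
  apply/funext => k; rewrite -big_undup_iterop_count; apply: eq_bigr => i _.
  by rewrite /c' mulrnAr.
have dist := sqdist_point k0 c' (undup_uniq s).
rewrite /ell2_norm /ell2_sqnorm ltr_sqrt// => distE.
have : 1 - \sum_(i <- undup s) qsqn (e i k0) +
    \sum_(i <- undup s) qsqn (c' i - qconj (e i k0)) < eps.
  rewrite -lte_fin -dist; move: distE; under eq_esum do rewrite sqr_qnorm.
  by rewrite dist.
have B0 : 0 <= \sum_(i <- undup s) qsqn (c' i - qconj (e i k0)).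
  by apply: sumr_ge0 => i _; exact: qsqn_ge0.
move=> lt_eps; apply: le_trans (_ : (\sum_(i <- undup s) qsqn (e i k0) + eps)%:E <= _)%E.
  by rewrite lee_fin; lra.
rewrite EFinD leeD2r// esum_ge//; exists [set` undup s]; first by split.
by rewrite -fsbig_seq ?undup_uniq// sumEFin.
Qed.

End Parseval.

(** * Splitting integer points into residues and multiples of [N] *)

Section Lattice.
Variable N : nat.
Hypothesis N_gt0 : (0 < N)%N.

Lemma residue_inj (r r' : 'I_N) (n n' : int) :
  r%:Z - n *+ N = r'%:Z - n' *+ N -> r = r' /\ n = n'.
Proof.
(* Reduction modulo [N] recovers the residue; the multiple then follows because [N] is nonzero. *)
have rE (r0 : 'I_N) (n0 : int) : ((r0%:Z - n0 *+ N) %% N)%Z = r0%:Z.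
  by rewrite -mulr_natr natz -mulNr addrC modzMDl modz_small// ltz_nat ltn_ord.
move=> E; have rr' : r = r' by apply/val_inj/eqP; rewrite -eqz_nat -(rE r n) E rE.
split=> //; move: E; rewrite rr' => /addrI/oppr_inj/eqP.
by rewrite -(mulr_natr n) -(mulr_natr n') natz => /eqP/mulIf -> //; rewrite eqz_nat -lt0n.
Qed.

Lemma residue_surj (k : int) : exists (r : 'I_N) (n : int), k = r%:Z - n *+ N.
Proof.
have N0 : N%:Z != 0 by rewrite eqz_nat -lt0n.
have lt_mod : (`|(k %% N)%Z| < N)%N.
  by rewrite -ltz_nat gez0_abs ?modz_ge0// ltz_pmod.
(* The quotient is negated because translation subtracts [n *+ N]. *)
exists (Ordinal lt_mod), (- (k %/ N)%Z).
rewrite /= gez0_abs ?modz_ge0// mulNrn opprK -mulr_natr natz addrC.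
exact: divz_eq.
Qed.

(** Division with remainder in each coordinate; [T] carries along the generator and modulation
    indices unchanged. *)
Lemma lattice_bij (T : Type) :
  set_bij [set: ('I_N * 'I_N) * (T * (int * int))] [set: T * (int * int)]
    (fun u => (u.2.1, (u.1.1%:Z, u.1.2%:Z) - u.2.2 *+ N)).
Proof.
split=> //.
- move=> [[r1 r2] [t [n1 n2]]] [[r1' r2'] [t' [n1' n2']]] _ _ /=.
  rewrite !pairMnE /= => -[-> /residue_inj[-> ->] /residue_inj[-> ->]].
  by [].
- move=> [t [k1 k2]] _.
  have [r1 [n1 ->]] := residue_surj k1; have [r2 [n2 ->]] := residue_surj k2.
  by exists ((r1, r2), (t, (n1, n2))) => //=; rewrite pairMnE.
Qed.

End Lattice.

(** * Constant and iterated sums of nonnegative terms *)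

Lemma esum_cst1 (R : realType) (T : finType) :
  \esum_(t in [set: T]) 1%E = #|T|%:R%:E :> \bar R.
Proof.
rewrite esum_fset//; last exact: finite_finset.
have <- : [set` enum T] = [set: T] by apply/seteqP; split=> t //= _; rewrite mem_enum.
by rewrite -fsbig_seq ?enum_uniq// big_enum sumEFin sumr_const.
Qed.

(** Tonelli's theorem for sums, used in both directions to change the order of summation. *)
Lemma esum_prodT (R : realType) (T1 T2 : choiceType) (a : T1 -> T2 -> \bar R) :
  (forall i j, 0 <= a i j)%E ->
  \esum_(i in [set: T1]) \esum_(j in [set: T2]) a i j =
  \esum_(u in [set: T1 * T2]) a u.1 u.2.
Proof.
by move=> a0; rewrite esum_esum//; congr esum; apply/seteqP; split.
Qed.

(** * Moduli of Gabor members and the counting identity *)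

Section GaborNorm.
Variables (R : realType) (L M N : nat) (g : 'I_L -> int * int -> quaternion R).

Lemma sqr_qnorm_gabor i k :
  qnorm (gabor M N g i k) ^+ 2 = qnorm (g i.1.1 (k - i.2 *+ N)) ^+ 2.
Proof.
case: i => [[l m] n]; rewrite /= /modulate /translate !sqr_qnorm !qsqnM.
by rewrite qsqn_qexpi qsqn_qexpj mul1r mulr1.
Qed.

End GaborNorm.

Unset Implicit Arguments.

Theorem lemma4 (R : realType) (L M N : nat)
    (L_gt0 : (0 < L)%N) (M_gt0 : (0 < M)%N) (N_gt0 : (0 < N)%N)
    (g : 'I_L -> int * int -> quaternion R)
    (g_ell2 : forall l : 'I_L, ell2 (g l))
    (g_basis : orthonormal_basis (gabor M N g)) :
  exists s : nat, L = (s ^ 2)%N.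
Proof.
have [e_ell2 e_orth e_dense] := g_basis.
have sqg l : ell2_sqnorm (g l) = 1%E.
  (* The member with zero translation has the same pointwise moduli as [g l]; positivity of [M]
     supplies a modulation index. *)
  pose m := Ordinal M_gt0.
  rewrite -(ell2_sqnorm_orthonormal e_ell2 e_orth (l, (m, m), 0)).
  by apply: eq_esum => k _; rewrite sqr_qnorm_gabor mul0rn subr0.
have : (N ^ 2 = L * M ^ 2)%N.
  apply/eqP; rewrite -(eqr_nat R) -eqe; apply/eqP.
  have cardN : (N ^ 2)%N = #|{: 'I_N * 'I_N}| by rewrite card_prod card_ord.
  have cardLM : (L * M ^ 2)%N = #|{: 'I_L * ('I_M * 'I_M)}| by rewrite !card_prod !card_ord.
  rewrite cardN cardLM.
  (* Summing over members first, each residue contributes 1 by Parseval. *)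
  transitivity (\esum_(r in [set: 'I_N * 'I_N])
    \esum_(i in [set: 'I_L * ('I_M * 'I_M) * (int * int)])
       (qnorm (gabor M N g i (r.1%:Z, r.2%:Z)) ^+ 2)%:E).
    rewrite -esum_cst1; apply: eq_esum => r _.
    by rewrite (parseval_point e_ell2 e_orth e_dense).
  rewrite esum_prodT => [|r i]; last by rewrite lee_fin sqr_ge0.
  under eq_esum do rewrite sqr_qnorm_gabor.
  (* Residues and translations together run once through all integer points, so each pair of
     generator and modulation contributes the squared norm of [g l]. *)
  rewrite -(reindex_esum _ _ _ (fun u : 'I_L * ('I_M * 'I_M) * (int * int) =>
    (qnorm (g u.1.1 u.2) ^+ 2)%:E) (lattice_bij N_gt0 _)).
  rewrite -(esum_prodT (a := fun lm k => (qnorm (g lm.1 k) ^+ 2)%:E)) => [|lm k]; last first.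
    by rewrite lee_fin sqr_ge0.
  rewrite -esum_cst1; apply: eq_esum => lm _.
  exact: sqg.
move=> NLM; exists (N %/ M)%N.
(* [M ^ 2] divides [N ^ 2], hence [M] divides [N], and cancelling [M ^ 2] leaves [L] as the square
   of the quotient. *)
have MN : (M %| N)%N by rewrite -(dvdn_pexp2r _ _ (isT : 0 < 2)%N) NLM dvdn_mull.
apply/eqP; rewrite -(@eqn_pmul2r (M ^ 2)) ?expn_gt0 ?M_gt0//.
by rewrite -NLM -expnMn divnK.
Qed.
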